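(* Let $G$ be a graph. Then there exists a one-to-one correspondence between the set of all semi-smooth travel groupoids on $G$ and the set of all semi-smooth T-partition systems on $G$.
   Context: Graphs are undirected, possibly infinite, with no loops and no multiple edges; write $G=(V,E)$. A travel groupoid is a nonempty set $V$ with binary operation $*$ satisfying (t1) $(u*v)*u=u$ for all $u,v$ and (t2) if $(u*v)*v=u$ then $u=v$; it is on $G$ if $V(G)=V$ and $E(G)=\{\{u,v\}\mid u\neq v,\ u*v=v\}$; it is semi-smooth if for all $u,v,w$, $u*v=u*w$ implies $u*(v*w)=u*v$ or $u*((v*w)*w)=u*v$. For $u\in V$, $N_G[u]=\{u\}\cup\{v\mid\{u,v\}\in E\}$. A T-partition system on $G$ is a family $(V_{u,v}\subseteq V\mid (u,v)\in V\times V)$ such that: (P0) for every $u$, $\{V_{u,v}\mid v\in N_G[u]\}$ is a partition of $V$; (P1a) $V_{u,u}=\{u\}$; (P1b) for $u\neq v$: $v\in V_{u,v}$ iff $\{u,v\}\in E$; (P1c) for $u\neq v$: $V_{u,v}=\emptyset$ iff $\{u,v\}\notin E$; (P2) for $u\neq v$: $V_{u,v}\cap V_{v,u}=\emptyset$. It is semi-smooth if (R5): for all $u,v,x,y,z,w\in V$, if $x,y\in V_{u,v}$ and $x\in V_{y,z}\cap V_{z,w}$ then $z\in V_{u,v}$ or $w\in V_{u,v}$. *)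

(* Defs.v *)
From mathcomp Require Import all_boot all_classical.

Set Implicit Arguments.
Unset Strict Implicit.
Unset Printing Implicit Defensive.

Local Open Scope classical_set_scope.

(* Edges are the two-element vertex sets [set u; v], so undirectedness, absence
   of loops and absence of multiple edges are built in. *)
Record graph (V : Type) := Graph {
  vertex_nonempty : [set: V] !=set0;
  edges : set (set V);
  edge_pair : forall e, edges e -> exists u v, u <> v /\ e = [set u; v] }.

Definition closed_nbhd (V : Type) (G : graph V) (u : V) : set V :=
  [set u] `|` [set v | edges G [set u; v]].

Definition travel_groupoid (V : Type) (op : V -> V -> V) : Prop :=
  [/\ [set: V] !=set0,
      forall u v, op (op u v) u = u &
      forall u v, op (op u v) v = u -> u = v].

Definition groupoid_on (V : Type) (G : graph V) (op : V -> V -> V) : Prop :=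
  edges G = [set e | exists u v, [/\ e = [set u; v], u <> v & op u v = v]].

Definition semi_smooth (V : Type) (op : V -> V -> V) : Prop :=
  forall u v w, op u v = op u w ->
    op u (op v w) = op u v \/ op u (op (op v w) w) = op u v.

Definition semi_smooth_travel_groupoids (V : Type) (G : graph V) :
    set (V -> V -> V) :=
  [set op | [/\ travel_groupoid op, groupoid_on G op & semi_smooth op]].

(* partition refers here to the indexed family (P u v) for v in N[u]:
   distinct indices have disjoint blocks.  If equal blocks with distinct
   indices were identified, the complete graph on 3 vertices would carry
   several systems but only one travel groupoid. *)
Definition T_partition_system (V : Type) (G : graph V)
    (P : V -> V -> set V) : Prop :=
  [/\ forall u, partition (closed_nbhd G u) (P u) [set: V],
      forall u, P u u = [set u],
      forall u v, u <> v -> (P u v v <-> edges G [set u; v]),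
      forall u v, u <> v -> (P u v = set0 <-> ~ edges G [set u; v]) &
      forall u v, u <> v -> P u v `&` P v u = set0].

Definition semi_smooth_system (V : Type) (P : V -> V -> set V) : Prop :=
  forall u v x y z w : V,
    P u v x -> P u v y -> (P y z `&` P z w) x -> P u v z \/ P u v w.

Definition semi_smooth_T_partition_systems (V : Type) (G : graph V) :
    set (V -> V -> set V) :=
  [set P | T_partition_system G P /\ semi_smooth_system P].

(* Main.v *)
Require Import Defs.
From mathcomp Require Import all_boot all_classical.

(** The correspondence sends [op] to the system with blocks
    [{w | op u w = v}]: the block containing [w] records the first step of the
    route from [u] to [w].  The partition axiom says exactly that such blocks
    come from a unique operation, and under this dictionary (P2) is (t2) and
    (R5) is semi-smoothness. *)

Local Open Scope classical_set_scope.

Definition first_step_system {V : Type} (op : V -> V -> V) (u v : V) : set V :=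
  [set w | op u w = v].

Lemma first_step_system_inj {V : Type} : injective (@first_step_system V).
Proof.
move=> op op' eq_sys; apply/funext => u; apply/funext => w.
have : first_step_system op u (op u w) w by [].
by rewrite eq_sys.
Qed.

(** In (R5) the membership of [x] forces [z = op y x] and [w = op z x], the first two steps from [y]
    towards [x], so (R5) is the semi-smooth law for the triple [u], [y], [x]. *)
Lemma semi_smooth_first_step_system {V : Type} (op : V -> V -> V) :
  semi_smooth_system (first_step_system op) <-> semi_smooth op.
Proof.
split=> [smooth u v w uvw|smooth u v x y z w ux uy [yx zx]].
- by apply: (smooth u _ w v); rewrite /first_step_system /=.
- rewrite /first_step_system /= in ux uy yx zx *.
  by have := smooth u y x; rewrite yx zx uy ux; apply.
Qed.

Section TravelGroupoid.
Context {V : Type} {op : V -> V -> V}.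
Hypothesis tg : travel_groupoid op.

(** Apply (t1) to the pair [op u v], [u], and replace [op (op u v) u] by [u], again by (t1). *)
Lemma travel_step u v : op u (op u v) = op u v.
Proof. by case: tg => _ t1 _; have := t1 (op u v) u; rewrite (t1 u v). Qed.

Lemma travel_idem u : op u u = u.
Proof.
by case: tg => _ t1 t2; apply: t2; rewrite t1.
Qed.

Lemma travel_stay u v : op u v = u -> u = v.
Proof. by case: tg => _ _ t2 uv; apply: t2; rewrite !uv. Qed.

Lemma travel_sym u v : op u v = v -> op v u = u.
Proof. by case: tg => _ t1 _ uv; have := t1 u v; rewrite uv. Qed.

End TravelGroupoid.

Lemma set2_eq_cases {T : Type} (a b c d : T) : a <> b ->
  [set a; b] = [set c; d] -> (a = c /\ b = d) \/ (a = d /\ b = c).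
Proof.
move=> ab E.
have : [set c; d] a by rewrite -E; left.
have : [set c; d] b by rewrite -E; right.
by move=> [/= bc|/= bd] [/= ac|/= ad];
  [case: ab; rewrite ac|right|left|case: ab; rewrite ad].
Qed.

Lemma edge_travel {V : Type} {G : graph V} {op : V -> V -> V} :
  travel_groupoid op -> groupoid_on G op ->
  forall u v, u <> v -> edges G [set u; v] <-> op u v = v.
Proof.
move=> tg on_G u v uv; rewrite on_G; split=> [[a [b [E _ ab]]]|]; last first.
  by move=> ?; exists u, v.
(* The edge may be witnessed in the reverse orientation. *)
by case: (set2_eq_cases _ _ _ _ uv E) => -[-> ->] //; apply: travel_sym.
Qed.

Lemma first_step_T_partition {V : Type} (G : graph V) (op : V -> V -> V) :
  travel_groupoid op -> groupoid_on G op ->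
  T_partition_system G (first_step_system op).
Proof.
move=> tg on_G; have edgeE := edge_travel tg on_G.
rewrite /first_step_system; split=> [u|u|u v uv|u v uv|u v uv].
- split.
  + rewrite -subTset => w _; exists (op u w) => //.
    have [->|ne] := EM (op u w = u); first by left.
    by right; apply/edgeE; [exact/nesym|exact: travel_step].
  + by move=> v v' _ _ [w [/= <- <-]].
  (* Each [v] in the closed neighbourhood lies in its own block. *)
  + move=> v nv; exists v => /=; have [<-|ne] := EM (u = v).
      exact: travel_idem.
    by case: nv => [/esym //|/edgeE]; apply.
- apply/seteqP; split=> w /=; first by move/(travel_stay tg).
  by move=> ->; exact: travel_idem.
- by rewrite /= edgeE.
- rewrite edgeE //; split=> [E uvv|nuv].
    by have : [set w | op u w = v] v by []; rewrite E.
  by rewrite -subset0 => w /= uw; apply: nuv; rewrite -uw; exact: travel_step.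
- rewrite -subset0 => x [/= ux vx]; apply: uv.
  (* A common point [x] satisfies [op (op u x) x = u], so (t2) gives [u = x], and then
     [v = op u u = u]. *)
  case: (tg) => _ _ t2; have eq_ux : u = x by apply: t2; rewrite ux.
  by move: ux; rewrite -eq_ux travel_idem.
Qed.

(** This is the surjectivity half; semi-smoothness can be left aside, as it transfers along
    [first_step_system op = P]. *)
Lemma T_partition_of_travel_groupoid {V : Type} (G : graph V)
    (P : V -> V -> set V) : T_partition_system G P ->
  exists op, [/\ travel_groupoid op, groupoid_on G op &
                 first_step_system op = P].
Proof.
case=> P0 P1a P1b P1c P2.
(* The partition axiom only separates blocks indexed by the closed neighbourhood; by (P1c) all
   others are empty. *)
have blockN u v w : P u v w -> closed_nbhd G u v.
  move=> Puvw; have [<-|uv] := EM (u = v); first by left.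
  by right; apply: contrapT => /(P1c _ _ uv) E; rewrite E in Puvw.
have [op opP] : exists op : V -> V -> V, forall u w, P u (op u w) w.
  have blockP u w : exists v, P u v w.
    have [cov _ _] := P0 u.
    have : [set: V] w by [].
    by rewrite -cov => -[v _ ?]; exists v.
  have [g gP] := choice (fun uw : V * V => blockP uw.1 uw.2).
  by exists (fun u w => g (u, w)) => u w; exact: gP (u, w).
have PE u v w : P u v w <-> op u w = v.
  split=> [Puvw|<- //]; have [_ triv _] := P0 u.
  by apply: triv; [exact: blockN (opP u w)|exact: blockN Puvw|exists w].
exists op; split.
- split; first exact: vertex_nonempty G.
  (* (t1) says that [u] lies in the block of [op u w] indexed by [u], which (P1b) reads off from the
     edge between them. *)
  + move=> u w; apply/PE; have [<-|ne] := EM (u = op u w).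
      by rewrite P1a.
    apply/(P1b _ _ (nesym ne)); rewrite setUC.
    by case: (blockN _ _ _ (opP u w)) => [/esym|].
  + move=> u v /PE Pv; have Puv := opP u v.
    (* Unless [op u v = u], the point [v] lies in two blocks that (P2) makes disjoint. *)
    have [E|ne] := EM (u = op u v); first by move: Puv; rewrite -E P1a => ->.
    have : (P u (op u v) `&` P (op u v) u) v by [].
    by rewrite P2.
- apply/seteqP; split=> e.
    move=> Ge; have [u [v [uv E]]] := @edge_pair _ G e Ge.
    by exists u, v; split=> //; apply/PE/P1b => //; rewrite -E.
  by move=> [u [v [-> uv /PE]]] /(P1b _ _ uv).
- apply/funext => u; apply/funext => v; apply/seteqP.
  by split=> w /PE.
Qed.

Theorem theorem4p16 (V : Type) (G : graph V) :
  exists f : (V -> V -> V) -> (V -> V -> set V),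
    set_bij (semi_smooth_travel_groupoids G)
            (semi_smooth_T_partition_systems G) f.
Proof.
exists first_step_system; split.
- move=> op [tg on_G smooth]; split; first exact: first_step_T_partition.
  exact/semi_smooth_first_step_system.
- by move=> op op' _ _; exact: first_step_system_inj.
- move=> P [sysP smooth].
  have [op [tg on_G E]] := T_partition_of_travel_groupoid G P sysP.
  by exists op => //; split=> //; apply/semi_smooth_first_step_system; rewrite E.
Qed.
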